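(* Let $T\subset\mathbb{R}^2$ be the closed equilateral triangle with vertices $(0,1)$, $\left(-\tfrac{\sqrt3}{2},-\tfrac12\right)$, $\left(\tfrac{\sqrt3}{2},-\tfrac12\right)$, and let $R\in\mathbb{R}^{2\times 2}$ be the rotation about the origin by angle $\tfrac{2\pi}{3}$. Let $\mathbf{x}$ be a random point uniformly distributed on $T$, and for $f:T\to\mathbb{R}$ define the three-point stochastic quadrature rule $$Q_M(f)=\frac{\sqrt3}{4}\left(f(\mathbf{x})+f(R\mathbf{x})+f(R^2\mathbf{x})\right).$$ Then $Q_M$ is of order $1$ and unbiased on $T$.
   Context: A stochastic quadrature rule on a bounded domain $\Omega_0\subset\mathbb{R}^d$ is a random functional $Q_M(f)=\sum_{j=1}^J f(\mathbf{x}_j)w_j$, where the points and weights $(\mathbf{x}_j,w_j)_{j=1}^J\in(\Omega_0\times\mathbb{R})^J$ are sampled from a probability measure. The rule is of order $p$ if, with probability $1$, $Q_M(f)=\int_{\Omega_0}f(\mathbf{x})\,d\mathbf{x}$ for every polynomial $f$ of degree at most $p$. The rule is unbiased if $\mathbb{E}(Q_M(f))=\int_{\Omega_0}f(\mathbf{x})\,d\mathbf{x}$ for all integrable $f:\Omega_0\to\mathbb{R}$. *)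

(* Defs.v *)
From HB Require Import structures.
From mathcomp Require Import all_boot all_order all_algebra.
From mathcomp Require Import all_classical all_reals all_analysis.
(* The notations of mpoly clash with those of mathcomp-analysis. *)
From mathcomp Require mpoly.
Import (canonicals, coercions) mpoly.
Import Order.TTheory GRing.Theory Num.Theory.
Import numFieldNormedType.Exports.

Set Implicit Arguments.
Unset Strict Implicit.
Unset Printing Implicit Defensive.

Local Open Scope classical_set_scope.
Local Open Scope ring_scope.

(* Points of R^2 are pairs rather than vectors 'cV[R]_2, because the library
   provides the Borel structure and the product measure for pairs. *)
Notation plane R := (measurableTypeR R * measurableTypeR R)%type.

Notation area R := (@lebesgue_measure R \x @lebesgue_measure R)%E.

Definition coords (R : realType) (x : plane R) : 'cV[R]_2 :=
  \col_(i < 2) (if i == 0 then x.1 else x.2).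

Definition act (R : realType) (A : 'M[R]_2) (x : plane R) : plane R :=
  let y := A *m coords x in (y 0 0, y 1 0).

Definition rotation (R : realType) (theta : R) : 'M[R]_2 :=
  \matrix_(i < 2, j < 2)
    (if i == j then cos theta else if i == 0 then - sin theta else sin theta).

Definition closed_triangle (R : realType) (a b c : plane R) :
    set (plane R) :=
  [set x | exists r s t : R, [/\ 0 <= r, 0 <= s, 0 <= t, r + s + t = 1 &
     x = (r * a.1 + s * b.1 + t * c.1, r * a.2 + s * b.2 + t * c.2)]].

Definition polyfun (R : realType) (p : mpoly.mpoly 2 R) (x : plane R) : R :=
  mpoly.meval (fun i => coords x i 0) p.

(* f is integrable on D for the completion of mu: for mu = area this is
   Lebesgue, not just Borel, integrability.  For such f the library integral
   (defined for all functions by suprema over simple functions) is the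
   integral with respect to the completion. *)
Definition lebesgue_integrable d (T : measurableType d) (R : realType)
    (mu : {measure set T -> \bar R}) (D : set T) (f : T -> R) : Prop :=
  exists2 g : T -> R, mu.-integrable D (EFin \o g) &
    {ae mu, forall x, D x -> f x = g x}.

Definition uniformly_distributed d (Om : measurableType d) (R : realType)
    (P : probability Om R) (X : {RV P >-> plane R}) (D : set (plane R)) :
    Prop :=
  forall A : set (plane R), measurable A ->
    distribution P X A = (area R (A `&` D) / area R D)%E.

(* A random functional, sending an integrand and an outcome to a real number,
   is a stochastic quadrature rule on D if it is a weighted sum over finitely
   many random points lying almost surely in D, with random weights.
   An integrand on D is represented by a function on the whole plane, whose
   values outside D are irrelevant. *)
Definition stochastic_quadrature d (Om : measurableType d) (R : realType)
    (P : probability Om R) (D : set (plane R))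
    (Q : (plane R -> R) -> Om -> R) : Prop :=
  exists (J : nat) (x : 'I_J -> {RV P >-> plane R})
         (w : 'I_J -> {RV P >-> measurableTypeR R}),
    (forall j, {ae P, forall o, D (x j o)}) /\
    forall f o, Q f o = \sum_(j < J) f (x j o) * w j o.

(* [mpoly.msize p] is one more than the total degree of p (0 if p = 0). *)
Definition quadrature_order d (Om : measurableType d) (R : realType)
    (P : probability Om R) (D : set (plane R)) (k : nat)
    (Q : (plane R -> R) -> Om -> R) : Prop :=
  {ae P, forall o, forall p : mpoly.mpoly 2 R, (mpoly.msize p <= k.+1)%N ->
    (Q (polyfun p) o)%:E = (\int[area R]_(x in D) (polyfun p x)%:E)%E}.

Definition quadrature_unbiased d (Om : measurableType d) (R : realType)
    (P : probability Om R) (D : set (plane R))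
    (Q : (plane R -> R) -> Om -> R) : Prop :=
  forall f : plane R -> R, lebesgue_integrable (area R) D f ->
    lebesgue_integrable P setT (Q f) /\
    ('E_P[Q f] = \int[area R]_(x in D) (f x)%:E)%E.

(* Main.v *)
Require Import Defs.
From HB Require Import structures.
From mathcomp Require Import all_boot all_order all_algebra.
From mathcomp Require Import all_classical all_reals all_analysis.
From mathcomp Require mpoly.
Import (canonicals, coercions) mpoly.
From mathcomp Require Import measurable_realfun ring lra.
Import Order.TTheory GRing.Theory Num.Theory.
Import numFieldNormedType.Exports.

Set Implicit Arguments.
Unset Strict Implicit.
Unset Printing Implicit Defensive.

Local Open Scope classical_set_scope.
Local Open Scope ring_scope.

(* The rotation by [2 pi / 3] is a product of three shears, and each shear
   preserves area by Fubini and the translation invariance of Lebesgue measure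
   on the line; it also maps the triangle T to itself.  Hence the integral over
   T of the orbit average (sqrt 3 / 4) (f + f o R + f o R^2) is
   (3 sqrt 3 / 4) int_T f = |T| int_T f, and transferring it to the law of the
   random point, which is area on T divided by |T|, gives unbiasedness.  For an
   affine f the orbit average is the constant |T| f(0), because the orbit of a
   point has centroid 0; the same identity then reads int_T f = |T| f(0). *)

(** * Integrals of functions that agree off a null set *)

Section negligible_eq_integral.
Context d (T : measurableType d) (R : realType).
Variable mu : {measure set T -> \bar R}.
Implicit Types f g : T -> \bar R.
Local Open Scope ereal_scope.
Import HBNNSimple.

(** The integral of [f] is a supremum over simple functions below [f]. Replacing such a function by
    zero on [N] keeps its integral and puts it below [g]. *)
Lemma ge0_negligible_le_integral (N : set T) f g :
  measurable N -> mu N = 0 -> (forall x, 0 <= f x) -> (forall x, 0 <= g x) ->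
  (forall x, ~ N x -> f x <= g x) -> \int[mu]_x f x <= \int[mu]_x g x.
Proof.
move=> mN N0 f0 g0 fg; rewrite [leLHS]ge0_integralTE//.
apply: ge_ereal_sup => _ [h /= hf <-].
have mCN : measurable (~` N) by exact: measurableC.
rewrite -integralT_nnsfun (ge0_negligible_integral mN)//; last 2 first.
  exact/measurable_EFinP.
  by move=> x _; rewrite lee_fin.
rewrite setTD integral_nnsfun// ge0_integralTE//.
apply: ereal_sup_ubound; rewrite mrestrict.
exists (proj_nnsfun h mCN) => //= x.
rewrite mindicE; case: (boolP (x \in ~` N)) => [|_]; last by rewrite mulr0.
by rewrite inE mulr1 => /fg; exact/le_trans/hf.
Qed.

(* Unlike in [ae_eq_integral], neither function has to be measurable: an
   integrand equal almost everywhere to a Borel function need not be. *)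
Lemma negligible_eq_integral (N D : set T) f g :
  measurable N -> mu N = 0 -> (forall x, D x -> ~ N x -> f x = g x) ->
  \int[mu]_(x in D) f x = \int[mu]_(x in D) g x.
Proof.
move=> mN N0 fg; rewrite integral_mkcond [RHS]integral_mkcond.
have {}fg x : ~ N x -> (f \_ D) x = (g \_ D) x.
  by move=> Nx; rewrite !patchE; case: ifPn => //; rewrite inE => /fg ->.
rewrite integralE [RHS]integralE.
congr (_ - _); apply/eqP; rewrite eq_le; apply/andP; split.
all: apply: (ge0_negligible_le_integral mN N0) => [x|x|x Nx].
all: first [exact: funepos_ge0 | exact: funeneg_ge0
  | by rewrite ?funeposE ?funenegE fg].
Qed.

End negligible_eq_integral.

(** * Translations, shears and rotations preserve area *)

Section lebesgue_area.
Variable R : realType.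

(** The pushforward under a translation gives half-open intervals their length, and this
    characterises Lebesgue measure. *)
Lemma lebesgue_measure_translation (c : R) (A : set (measurableTypeR R)) :
  measurable A ->
  lebesgue_measure ((fun y => y + c) @^-1` A) = lebesgue_measure A.
Proof.
move=> mA.
have mc : measurable_fun [set: measurableTypeR R]
    (fun y => y + c : measurableTypeR R).
  by apply: measurable_funD; [exact: measurable_id|exact: measurable_cst].
rewrite -[LHS]/(pushforward lebesgue_measure
  (fun y : measurableTypeR R => y + c : measurableTypeR R) A).
apply/esym/lebesgue_measure_unique => //= _ [[a b]] _ <-.
rewrite /pushforward /=.
have -> : (fun y => y + c) @^-1` `]a, b] = `]a - c, b - c]%classic.
  by apply/seteqP; split => x /=; rewrite !in_itv/=; lra.
rewrite !lebesgue_measure_itv/= !lte_fin ltrD2r.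
by case: ifP => // _; rewrite -!EFinD; congr EFin; ring.
Qed.

Definition shear1 (c : R) (x : plane R) : plane R := (x.1 + c * x.2, x.2).
Definition shear2 (c : R) (x : plane R) : plane R := (x.1, x.2 + c * x.1).

Lemma measurable_shear1 c : measurable_fun [set: plane R] (shear1 c).
Proof.
apply: measurable_fun_pair; last exact: measurable_snd.
apply: measurable_funD; first exact: measurable_fst.
by apply: measurable_funM; [exact: measurable_cst|exact: measurable_snd].
Qed.

Lemma measurable_shear2 c : measurable_fun [set: plane R] (shear2 c).
Proof.
apply: measurable_fun_pair; first exact: measurable_fst.
apply: measurable_funD; first exact: measurable_snd.
by apply: measurable_funM; [exact: measurable_cst|exact: measurable_fst].
Qed.

(** Both iterated measures have the same values on rectangles, hence coincide. Horizontal sections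
    are what [shear1] translates. *)
Lemma area_swap (A : set (plane R)) : measurable A ->
  area R A = (\int[lebesgue_measure]_y lebesgue_measure (ysection A y))%E.
Proof.
move=> mA.
apply: (@product_measure_unique _ _ _ _ R lebesgue_measure lebesgue_measure
  (@lebesgue_measure R \x^ @lebesgue_measure R)%E) => // B C mB mC.
exact: product_measure2E.
Qed.

Lemma area_shear1 c (A : set (plane R)) : measurable A ->
  area R (shear1 c @^-1` A) = area R A.
Proof.
move=> mA; rewrite !area_swap//; last first.
  by rewrite -[_ @^-1` _]setTI; exact: measurable_shear1.
apply: eq_integral => y _.
rewrite -[RHS](lebesgue_measure_translation (c * y)); last first.
  exact: measurable_ysection.
by congr (lebesgue_measure _).
Qed.

(** The product measure is by definition the integral over vertical sections, and on the vertical
    line at abscissa [x] the shear is the translation by [c * x]. *)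
Lemma area_shear2 c (A : set (plane R)) : measurable A ->
  area R (shear2 c @^-1` A) = area R A.
Proof.
move=> mA; apply: eq_integral => x _ /=.
rewrite -[RHS](lebesgue_measure_translation (c * x)); last first.
  exact: measurable_xsection.
by congr (lebesgue_measure _).
Qed.

Lemma act_fst (A : 'M[R]_2) (x : plane R) :
  (act A x).1 = A 0 0 * x.1 + A 0 1 * x.2.
Proof.
rewrite /act/= mxE big_ord_recl big_ord1 !mxE/=.
by rewrite (_ : lift _ _ = 1)//; exact/val_inj.
Qed.

Lemma act_snd (A : 'M[R]_2) (x : plane R) :
  (act A x).2 = A 1 0 * x.1 + A 1 1 * x.2.
Proof.
rewrite /act/= mxE big_ord_recl big_ord1 !mxE/=.
by rewrite (_ : lift _ _ = 1)//; exact/val_inj.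
Qed.

Lemma act_mul (A B : 'M[R]_2) (x : plane R) : act (A * B) x = act A (act B x).
Proof.
rewrite /act/=.
have -> : coords ((B *m coords x) 0 0, (B *m coords x) 1 0) = B *m coords x.
  apply/matrixP => i j; rewrite [LHS]mxE (ord1 j)/=.
  case: (unliftP 0 i) => [k ->|-> //]; rewrite (ord1 k).
  by rewrite (_ : lift _ _ = 1)//; exact/val_inj.
by rewrite mulmxA.
Qed.

Lemma measurable_act (A : 'M[R]_2) : measurable_fun [set: plane R] (act A).
Proof.
have -> : act A = fun x : plane R =>
    (A 0 0 * x.1 + A 0 1 * x.2, A 1 0 * x.1 + A 1 1 * x.2).
  by apply/funext => x; rewrite -act_fst -act_snd; case: (act A x).
have maff a b : measurable_fun [set: plane R] (fun x => a * x.1 + b * x.2).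
  by apply: measurable_funD; exact: measurable_funM.
by apply: measurable_fun_pair; exact: maff.
Qed.

(** Here [t] is the tangent of [theta / 2]; its only properties used are the half-angle identities
    [ts] and [tc]. *)
Lemma rotation_shear (theta : R) : sin theta != 0 ->
  let t := (1 - cos theta) / sin theta in
  act (rotation theta) = shear1 (- t) \o shear2 (sin theta) \o shear1 (- t).
Proof.
move=> s0 t; apply/funext => -[u v].
have /eqP ts : t * sin theta = 1 - cos theta by rewrite /t mulfVK.
have /eqP tc : t * (1 + cos theta) = sin theta.
  apply/eqP; rewrite -(inj_eq (mulIf s0)) mulrAC (eqP ts) -expr2 sin2cos2.
  by apply/eqP; ring.
move: ts tc; rewrite -subr_eq0 => /eqP ts; rewrite -subr_eq0 => /eqP tc.
rewrite [LHS]surjective_pairing act_fst act_snd /rotation !mxE.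
rewrite /shear1 /shear2/=; congr pair; apply/eqP; rewrite -subr_eq0; apply/eqP.
  (* The difference of the two sides is a combination of the vanishing left-hand sides of [ts] and
     [tc]. *)
  transitivity ((t * sin theta - (1 - cos theta)) * (u - t * v)
    + (t * (1 + cos theta) - sin theta) * v); first by ring.
  by rewrite ts tc !mul0r addr0.
transitivity ((t * sin theta - (1 - cos theta)) * v); first by ring.
by rewrite ts mul0r.
Qed.

Lemma area_rotation (theta : R) (A : set (plane R)) : sin theta != 0 ->
  measurable A -> area R (act (rotation theta) @^-1` A) = area R A.
Proof.
move=> s0 mA; rewrite rotation_shear// !comp_preimage.
have m1 c B : measurable B -> measurable (shear1 c @^-1` B).
  by move=> mB; rewrite -[_ @^-1` _]setTI; exact: measurable_shear1.
have m2 c B : measurable B -> measurable (shear2 c @^-1` B).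
  by move=> mB; rewrite -[_ @^-1` _]setTI; exact: measurable_shear2.
by rewrite !(area_shear1, area_shear2) //; auto.
Qed.

(** Tripling the angle gives [2 * pi], so the cosine is a root of a cubic. The root [1] is excluded
    by injectivity of [cos] between 0 and [pi]. *)
Lemma cos_two_thirds_pi : cos (2 * pi / 3) = - (1 / 2) :> R.
Proof.
set x : R := 2 * pi / 3.
have x0 : 0 < x < pi.
  by have := pi_gt0 R; rewrite /x => ?; apply/andP; split; lra.
have c3 : 4 * cos x ^+ 3 - 3 * cos x = 1.
  have : cos (x *+ 2 + x) = 1.
    rewrite -[RHS]cos2pi; congr cos; rewrite /x; lra.
  rewrite cosD cos_mulr2n sin_mulr2n => h.
  have /(congr1 (fun z => cos x * z *+ 2))/= := sin2cos2 x.
  lra.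
(* 4 c^3 - 3 c - 1 = (c - 1) (2 c + 1)^2 *)
have /eqP : (cos x - 1) * (cos x + 1 / 2) ^+ 2 = 0 by nra.
rewrite mulf_eq0 expf_eq0/= => /orP[|]; last by move=> /eqP; lra.
rewrite subr_eq0 -[X in _ == X]cos0 => /eqP /cos_inj; rewrite !in_itv/=.
by move: x0 => /andP[? ?] H; exfalso; have := H _ _; lra.
Qed.

Lemma sin_two_thirds_pi : sin (2 * pi / 3) = Num.sqrt 3 / 2 :> R.
Proof.
have s0 : 0 <= sin (2 * pi / 3 : R).
  by apply: sin_ge0_pi; have := pi_gt0 R => ?; apply/andP; split; lra.
have q0 : 0 <= Num.sqrt 3 / 2 :> R by rewrite divr_ge0// sqrtr_ge0.
apply/eqP; rewrite -(eqrXn2 (n := 2))// sin2cos2 cos_two_thirds_pi.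
by rewrite expr_div_n sqr_sqrtr; [apply/eqP; field|lra].
Qed.

(** * The triangle: half-planes, area and rotational symmetry *)

Definition equilateral_triangle : set (plane R) :=
  closed_triangle (0, 1) (- (Num.sqrt 3 / 2), - (1 / 2))
    (Num.sqrt 3 / 2, - (1 / 2)).

Local Notation T := equilateral_triangle.
Local Notation rot := (rotation (2 * pi / 3) : 'M[R]_2).

Let sqrt3 : Num.sqrt 3 * Num.sqrt 3 = 3 :> R.
Proof. by rewrite -expr2 sqr_sqrtr. Qed.

Let sqrt3_gt0 : 0 < Num.sqrt 3 :> R.
Proof. by rewrite sqrtr_gt0. Qed.

Lemma equilateral_triangleE : T = [set x | [/\ - (1 / 2) <= x.2,
  x.2 + Num.sqrt 3 * x.1 <= 1 & x.2 - Num.sqrt 3 * x.1 <= 1]].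
Proof.
apply/seteqP; split => [x [r [s [t [r0 s0 t0 rst ->]]]]|[u v]/= [h1 h2 h3]].
  by split => /=; have := sqrt3; nra.
(* These are the barycentric coordinates; each is a multiple of the slack in one of the three
   inequalities. *)
exists ((1 + 2 * v) / 3), ((1 - v - Num.sqrt 3 * u) / 3),
  ((1 - v + Num.sqrt 3 * u) / 3); split; [lra|lra|lra|lra|].
congr pair => /=; last by lra.
transitivity (Num.sqrt 3 * Num.sqrt 3 / 3 * u); last by lra.
by rewrite sqrt3; lra.
Qed.

Lemma measurable_equilateral_triangle : measurable T.
Proof.
have mhalf a b c : measurable [set x : plane R | a * x.1 + b * x.2 <= c].
  rewrite -preimage_itvNyc -[_ @^-1` _]setTI.
  have : measurable_fun [set: plane R] (fun x => a * x.1 + b * x.2).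
    by apply: measurable_funD; exact: measurable_funM.
  by apply => //; exact: measurable_itv.
rewrite equilateral_triangleE.
rewrite (_ : [set x | _] = [set x : plane R | 0 * x.1 + - 1 * x.2 <= 1 / 2] `&`
   [set x | Num.sqrt 3 * x.1 + 1 * x.2 <= 1] `&`
   [set x | - Num.sqrt 3 * x.1 + 1 * x.2 <= 1]).
  by apply: measurableI; first exact: measurableI.
by apply/seteqP; split => x /=; [move=> [? ? ?]|move=> [[? ?] ?]];
   repeat split; lra.
Qed.

Lemma area_equilateral_triangle : area R T = (3 * Num.sqrt 3 / 4)%:E.
Proof.
rewrite area_swap; last exact: measurable_equilateral_triangle.
(* For [y > 1] the endpoints are in the wrong order and the interval is empty, so only the lower
   bound on [y] is tested. *)
have yT y : ysection T y = if - (1 / 2) <= y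
    then `[(y - 1) / Num.sqrt 3, (1 - y) / Num.sqrt 3]%classic else set0.
  apply/seteqP; split => x; rewrite /ysection/= inE equilateral_triangleE/=.
    move=> [h1 h2 h3]; rewrite h1/= in_itv/= ler_pdivrMr// ler_pdivlMr//.
    by apply/andP; split; lra.
  case: ifPn => //= h1; rewrite in_itv/= ler_pdivrMr// ler_pdivlMr//.
  by move=> /andP[? ?]; split; lra.
pose f (y : R) : R := (2 - 2 * y) / Num.sqrt 3.
pose D : set R := `[- (1 / 2), 1]%classic.
transitivity (\int[lebesgue_measure]_(y in D) (f y)%:E)%E.
  rewrite [RHS]integral_mkcond; apply: eq_integral => y _.
  rewrite yT patchE /D mem_setE in_itv/=; case: ifPn => h1/=;
    last exact: measure0.
  rewrite lebesgue_measure_itv/= lte_fin ltr_pdivrMr// mulfVK ?gt_eqF//.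
  (* The length formula tests a strict inequality of endpoints; at the apex [y = 1] the section is a
     single point and [f y] is 0. *)
  case: ltP => h2; case: (leP y 1) => h3 //.
  - by rewrite -EFinD; congr EFin; rewrite /f; lra.
  - by exfalso; lra.
  - by rewrite /f (_ : y = 1) ?mulr1 ?subrr ?mul0r//; lra.
pose F (y : R) : R := (2 * y - y ^+ 2) / Num.sqrt 3.
have dF (y : R) : is_derive y 1 F (f y).
  rewrite /F /f; apply: is_derive_eq; rewrite /GRing.scale/=; ring.
have cF : continuous F.
  by move=> y; apply/differentiable_continuous/derivable1_diffP; case: (dF y).
rewrite /D (@continuous_FTC2 _ f F); [|lra| | |].
- rewrite -EFinB; congr EFin; rewrite /F -mulrBl.
  apply: (mulIf (lt0r_neq0 sqrt3_gt0)); rewrite mulfVK ?gt_eqF// mulrAC.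
  by rewrite -(mulrA 3) sqrt3; lra.
- apply: continuous_subspaceT => y.
  apply: cvgM; last exact: cvg_cst.
  by apply: cvgB; [exact: cvg_cst|apply: cvgM; [exact: cvg_cst|exact: cvg_id]].
- split.
  + by move=> y _; case: (dF y).
  + exact/cvg_at_right_filter/cF.
  + exact/cvg_at_left_filter/cF.
- by move=> y _; rewrite derive1E; apply: derive_val.
Qed.

Lemma act_rot_fst (x : plane R) :
  (act rot x).1 = - (1 / 2) * x.1 - Num.sqrt 3 / 2 * x.2.
Proof.
by rewrite act_fst !mxE/= cos_two_thirds_pi sin_two_thirds_pi; ring.
Qed.

Lemma act_rot_snd (x : plane R) :
  (act rot x).2 = Num.sqrt 3 / 2 * x.1 - 1 / 2 * x.2.
Proof.
by rewrite act_snd !mxE/= cos_two_thirds_pi sin_two_thirds_pi; ring.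
Qed.

(** The rotation permutes cyclically the three inequalities that define the triangle. *)
Lemma act_rot_triangle (x : plane R) : T (act rot x) <-> T x.
Proof.
rewrite equilateral_triangleE !mksetE act_rot_fst act_rot_snd.
have e : Num.sqrt 3 * (- (1 / 2) * x.1 - Num.sqrt 3 / 2 * x.2) =
    - (Num.sqrt 3 * x.1) / 2 - 3 / 2 * x.2.
  by have := congr1 (fun z => z * x.2) sqrt3 => /=; lra.
by rewrite e; split => -[? ? ?]; split; lra.
Qed.

Lemma preimage_act_rot_triangle : act rot @^-1` T = T.
Proof. by apply/seteqP; split => x /act_rot_triangle. Qed.

Lemma measurable_preimage_act (A : 'M[R]_2) (B : set (plane R)) :
  measurable B -> measurable (act A @^-1` B).
Proof. by move=> mB; rewrite -[_ @^-1` _]setTI; exact: measurable_act. Qed.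

Lemma area_act_rot (A : set (plane R)) : measurable A ->
  area R (act rot @^-1` A) = area R A.
Proof.
apply: area_rotation; rewrite sin_two_thirds_pi.
by rewrite mulf_neq0 ?gt_eqF// invr_gt0.
Qed.

(** This is [1 + rot + rot ^+ 2 = 0], read coordinatewise. *)
Lemma act_rot_orbit_sum (x : plane R) :
  x.1 + (act rot x).1 + (act rot (act rot x)).1 = 0 /\
  x.2 + (act rot x).2 + (act rot (act rot x)).2 = 0.
Proof.
by rewrite !(act_rot_fst, act_rot_snd); split;
  have := congr1 (fun z => z * x.1) sqrt3;
  have := congr1 (fun z => z * x.2) sqrt3 => /=; lra.
Qed.

End lebesgue_area.

Arguments equilateral_triangle : clear implicits.

(** * Change of variables along a measurable map *)

Section transfer.
Context d1 d2 (X : measurableType d1) (Y : measurableType d2) (R : realType).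
Variables (phi : X -> Y) (mphi : measurable_fun [set: X] phi).
Variables (mu : {measure set X -> \bar R}) (nu : {measure set Y -> \bar R}).
Variables (D : set Y) (mD : measurable D).
(** Two uses are intended: [phi] the rotation with area on both sides, and [phi] the random point
    with [nu] the normalised area. In the second, the measures match only inside the triangle,
    whence the restriction to subsets of [D]. *)
Hypothesis mu_nu :
  forall A, measurable A -> A `<=` D -> mu (phi @^-1` A) = nu A.
Local Open Scope ereal_scope.

Lemma ge0_integral_transfer (f : Y -> \bar R) : measurable_fun D f ->
  (forall y, 0 <= f y) ->
  \int[mu]_(x in phi @^-1` D) f (phi x) = \int[nu]_(y in D) f y.
Proof.
move=> mf f0; rewrite -(ge0_integral_pushforward mphi)//.
exact: eq_measure_integral.
Qed.

Lemma integral_transfer (f : Y -> \bar R) : measurable_fun D f ->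
  \int[mu]_(x in phi @^-1` D) f (phi x) = \int[nu]_(y in D) f y.
Proof.
move=> mf; rewrite integralE [RHS]integralE.
rewrite -(ge0_integral_transfer (measurable_funepos mf)); last first.
  by move=> y; exact: funepos_ge0.
rewrite -(ge0_integral_transfer (measurable_funeneg mf)); last first.
  by move=> y; exact: funeneg_ge0.
by congr (_ - _); apply: eq_integral => x _; rewrite ?funeposE ?funenegE.
Qed.

Lemma integrable_transfer (f : Y -> \bar R) : nu.-integrable D f ->
  mu.-integrable (phi @^-1` D) (f \o phi).
Proof.
move=> /integrableP[mf foo]; apply/integrableP; split.
  apply: (measurable_comp mD) => //; last exact: measurable_funTS.
  by move=> _ [x Dx <-].
rewrite (ge0_integral_transfer (f := abse \o f)) => //.
  exact: measurableT_comp.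
by move=> y; exact: abse_ge0.
Qed.

End transfer.

(** * Integration against a scaled measure *)

Lemma integral_mscale d (T : measurableType d) (R : realType)
    (m : {measure set T -> \bar R}) (D : set T) (k : {nonneg R})
    (f : T -> \bar R) : measurable D -> m.-integrable D f ->
  (\int[mscale k m]_(x in D) f x = k%:num%:E * \int[m]_(x in D) f x)%E.
Proof.
move=> mD fi; have mf := measurable_int _ fi.
(* Distributing the factor requires a well-defined extended-real difference; the positive part has a
   finite integral. *)
rewrite [LHS]integralE [X in _ = (_ * X)%E]integralE muleBr//; last first.
  by apply: fin_num_adde_defr; exact: integrable_pos_fin_num.
rewrite !ge0_integral_mscale//.
- exact: measurable_funeneg.
- exact: measurable_funepos.
Qed.

Lemma integrable_mscale d (T : measurableType d) (R : realType)
    (m : {measure set T -> \bar R}) (D : set T) (k : {nonneg R})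
    (f : T -> \bar R) : measurable D -> m.-integrable D f ->
  (mscale k m).-integrable D f.
Proof.
move=> mD /integrableP[mf foo]; apply/integrableP; split => //.
rewrite ge0_integral_mscale//; last exact: measurableT_comp.
by rewrite lte_mul_pinfty.
Qed.

(** * The orbit average and its integral over the triangle *)

Section triangle_quadrature.
Variable R : realType.
Local Notation T := (equilateral_triangle R).
Local Notation rot := (rotation (2 * pi / 3) : 'M[R]_2).

(** The rule as a deterministic function of the sampled point. The weight is a third of the area of
    the triangle. *)
Definition orbit_average (f : plane R -> R) (x : plane R) : R :=
  Num.sqrt 3 / 4 * (f x + f (act rot x) + f (act (rot ^+ 2) x)).

Lemma integrable_act_rot (f : plane R -> R) :
  (area R).-integrable T (EFin \o f) ->
  (area R).-integrable T (EFin \o (f \o act rot)).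
Proof.
move=> fi; rewrite -[X in _.-integrable X _]preimage_act_rot_triangle.
apply: (integrable_transfer (measurable_act rot)
  (@measurable_equilateral_triangle R) _ fi) => A mA _.
exact: area_act_rot.
Qed.

Lemma integral_act_rot (f : plane R -> R) :
  measurable_fun T f ->
  (\int[area R]_(x in T) (f (act rot x))%:E =
   \int[area R]_(x in T) (f x)%:E)%E.
Proof.
move=> mf; rewrite -[X in integral _ X _ = _]preimage_act_rot_triangle.
apply: (integral_transfer (measurable_act rot)
  (@measurable_equilateral_triangle R) _ (f := EFin \o f)) => [A mA _|].
  exact: area_act_rot.
exact/measurable_EFinP.
Qed.

Lemma act_rot2 (x : plane R) : act (rot ^+ 2) x = act rot (act rot x).
Proof. by rewrite expr2 act_mul. Qed.

Lemma integrable_orbit_average (f : plane R -> R) :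
  (area R).-integrable T (EFin \o f) ->
  (area R).-integrable T (EFin \o orbit_average f).
Proof.
move=> f0; have f1 := integrable_act_rot f0; have f2 := integrable_act_rot f1.
have mT := @measurable_equilateral_triangle R.
have := integrableZl mT (Num.sqrt 3 / 4)
  (integrableD mT (integrableD mT f0 f1) f2).
apply: eq_integrable => // x _.
by rewrite /= /orbit_average act_rot2 -!EFinD -EFinM.
Qed.

Lemma integral_orbit_average (f : plane R -> R) :
  (area R).-integrable T (EFin \o f) ->
  (\int[area R]_(x in T) (orbit_average f x)%:E =
   area R T * \int[area R]_(x in T) (f x)%:E)%E.
Proof.
move=> f0; have f1 := integrable_act_rot f0; have f2 := integrable_act_rot f1.
have mT := @measurable_equilateral_triangle R.
have m0 : measurable_fun T f.
  by apply/measurable_EFinP; exact: measurable_int f0.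
have m1 : measurable_fun T (f \o act rot).
  by apply/measurable_EFinP; exact: measurable_int f1.
transitivity (\int[area R]_(x in T) ((Num.sqrt 3 / 4)%:E *
    ((f x)%:E + (f (act rot x))%:E + (f (act rot (act rot x)))%:E)))%E.
  by apply: eq_integral => x _; rewrite /orbit_average act_rot2.
rewrite integralZl//; last exact: (integrableD mT (integrableD mT f0 f1) f2).
rewrite (integralD mT (integrableD mT f0 f1) f2) (integralD mT f0 f1).
rewrite (integral_act_rot m1) (integral_act_rot m0).
rewrite area_equilateral_triangle.
(* Finiteness of the integral reduces the claim to an identity between reals. *)
have /fineK <- := integrable_fin_num mT f0.
by rewrite -!EFinD -!EFinM; congr EFin; field.
Qed.

Lemma act1 (x : plane R) : act 1 x = x.
Proof.
rewrite [LHS]surjective_pairing act_fst act_snd !mxE/=.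
rewrite !mul1r !mul0r add0r addr0.
by case: x.
Qed.

Lemma act_rot_iter_triangle (j : nat) (x : plane R) :
  T x -> T (act (rot ^+ j) x).
Proof.
move=> Tx; elim: j => [|j IH]; first by rewrite expr0 act1.
by rewrite exprS act_mul; exact/act_rot_triangle.
Qed.

Lemma polyfun_affine (p : mpoly.mpoly 2 R) : (mpoly.msize p <= 2)%N ->
  exists a b c : R, forall x, polyfun p x = c + a * x.1 + b * x.2.
Proof.
move=> p2; pose Aff (F : plane R -> R) :=
  exists a b c : R, forall x, F x = c + a * x.1 + b * x.2.
suff : Aff (fun x => \sum_(m <- mpoly.msupp p) mpoly.mcoeff m p *
    \prod_(i < 2) coords x i 0 ^+ mpoly.fun_of_multinom m i).
  move=> [a [b [c E]]]; exists a, b, c => x.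
  by rewrite -E /polyfun mpoly.mevalE.
have : forall m, m \in mpoly.msupp p -> (mpoly.mdeg m < 2)%N.
  by move=> m /mpoly.msize_mdeg_lt /leq_trans; exact.
(* The induction runs over any list of monomials of degree below 2, with coefficients still taken
   from [p]. Each monomial changes exactly one of [a], [b], [c]. *)
elim: (mpoly.msupp p : seq _) => [_|m s IH sd].
  by exists 0, 0, 0 => x; rewrite big_nil; ring.
have [|a [b [c E]]] := IH; first by move=> n ns; apply: sd; rewrite inE ns orbT.
have : (mpoly.mdeg m < 2)%N by apply: sd; rewrite inE eqxx.
rewrite mpoly.mdegE big_ord_recl big_ord1.
pose k := mpoly.mcoeff m p.
have e1 (G : 'I_2 -> R) : \prod_i G i = G 0 * G 1.
  by rewrite big_ord_recl big_ord1; congr (_ * G _); exact/val_inj.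
have -> : lift ord0 ord0 = 1 :> 'I_2 by exact/val_inj.
case E0 : (mpoly.fun_of_multinom m 0) => [|[|?]] //;
case E1 : (mpoly.fun_of_multinom m 1) => [|[|?]] // _.
- exists a, b, (c + k) => x; rewrite big_cons E e1 E0 E1 !mxE/= !expr0 -/k.
  ring.
- exists a, (b + k), c => x; rewrite big_cons E e1 E0 E1 !mxE/= !expr0 !expr1 -/k.
  ring.
- exists (a + k), b, c => x; rewrite big_cons E e1 E0 E1 !mxE/= !expr0 !expr1 -/k.
  ring.
Qed.

Lemma integrable_affine (a b c : R) :
  (area R).-integrable T (EFin \o (fun x => c + a * x.1 + b * x.2)).
Proof.
apply: measurable_bounded_integrable.
- exact: measurable_equilateral_triangle.
- by rewrite [ltLHS]area_equilateral_triangle ltry.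
- apply: measurable_funTS; apply: measurable_funD; last exact: measurable_funM.
  by apply: measurable_funD => //; exact: measurable_funM.
(* Both coordinates of a point of the triangle are at most 1 in absolute value. *)
exists (`|c| + `|a| + `|b|); split; first exact: num_real.
move=> M /ltW leM x; rewrite /= equilateral_triangleE => -[h1 h2 h3].
apply: le_trans leM.
have q0 : 0 < Num.sqrt 3 :> R by rewrite sqrtr_gt0.
have q3 : Num.sqrt 3 * Num.sqrt 3 = 3 :> R by rewrite -expr2 sqr_sqrtr.
have x1 : `|x.1| <= 1 by rewrite ler_norml; apply/andP; split; nra.
have x2 : `|x.2| <= 1 by rewrite ler_norml; apply/andP; split; nra.
apply: (le_trans (ler_normD _ _)); apply: lerD.
  apply: (le_trans (ler_normD _ _)); apply: lerD => //.
  by rewrite normrM ler_piMr.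
by rewrite normrM ler_piMr.
Qed.

Lemma orbit_average_affine (a b c : R) (x : plane R) :
  orbit_average (fun x => c + a * x.1 + b * x.2) x = 3 * Num.sqrt 3 / 4 * c.
Proof.
have [s1 s2] := act_rot_orbit_sum x.
rewrite /orbit_average act_rot2.
move: s1 s2; move: (act rot (act rot x)) => z.
move: (act rot x) => y s1 s2 /=.
transitivity (Num.sqrt 3 / 4 * (3 * c + a * (x.1 + y.1 + z.1)
  + b * (x.2 + y.2 + z.2))); first by ring.
by rewrite s1 s2 !mulr0 !addr0; ring.
Qed.

(** The orbit average is constant, so its integral is the squared area times [c]; it is also the
    area times the wanted integral, and one factor cancels. *)
Lemma integral_affine (a b c : R) :
  (\int[area R]_(x in T) (c + a * x.1 + b * x.2)%:E =
   (3 * Num.sqrt 3 / 4 * c)%:E)%E.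
Proof.
have fi := integrable_affine a b c.
have mT := @measurable_equilateral_triangle R.
have := integral_orbit_average fi.
under eq_integral do rewrite orbit_average_affine.
rewrite integral_cst// area_equilateral_triangle.
rewrite [X in (_ * X)%E = _]area_equilateral_triangle.
have /fineK := integrable_fin_num mT fi.
rewrite /=; set I := (\int[_]_(_ in _) _)%E => <- /=.
rewrite -!EFinM => H; have E := EFin_inj H; congr EFin.
have q0 : 3 * Num.sqrt 3 / 4 != 0 :> R.
  by rewrite mulf_neq0// mulf_neq0// gt_eqF// sqrtr_gt0.
by apply: (mulfI q0); rewrite -E mulrC.
Qed.

(** * The law of the random point and the properties of the rule *)

Section law.
Context d (Om : measurableType d) (P : probability Om R).
Variable X : {RV P >-> plane R}.
Hypothesis XT : uniformly_distributed X T.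

Let mT := @measurable_equilateral_triangle R.
Let k := 3 * Num.sqrt 3 / 4 : R.
Let k_gt0 : 0 < k.
Proof. by rewrite /k divr_gt0// mulr_gt0// sqrtr_gt0. Qed.

(** This is the matching condition of the transfer lemmas, with area scaled by [k^-1] as target
    measure. *)
Lemma law_subset (A : set (plane R)) : measurable A -> A `<=` T ->
  P (X @^-1` A) = (k^-1%:E * area R A)%E.
Proof.
move=> mA AT; have := XT mA.
rewrite setIidl// area_equilateral_triangle -/k inver gt_eqF// muleC => <-.
by [].
Qed.

Lemma law_null (N : set (plane R)) : measurable N ->
  area R (N `&` T) = 0%E -> P (X @^-1` N) = 0%E.
Proof. by move=> mN N0; have := XT mN; rewrite N0 mul0e. Qed.

Let kV_ge0 : 0 <= k^-1. Proof. by rewrite invr_ge0 ltW. Qed.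

Let kV : {nonneg R} := NngNum kV_ge0.

Lemma integrable_law (f : plane R -> R) : (area R).-integrable T (EFin \o f) ->
  P.-integrable (X @^-1` T) (EFin \o (f \o X)).
Proof.
move=> fi.
apply: (integrable_transfer (nu := mscale kV (area R)) _ mT _ (f := EFin \o f)).
- exact: measurable_funP.
- exact: law_subset.
- exact: integrable_mscale.
Qed.

Lemma integral_law (f : plane R -> R) : (area R).-integrable T (EFin \o f) ->
  (\int[P]_(o in X @^-1` T) (f (X o))%:E =
   k^-1%:E * \int[area R]_(x in T) (f x)%:E)%E.
Proof.
move=> fi; rewrite -[k^-1]/(kV%:num) -integral_mscale//.
apply: (integral_transfer (nu := mscale kV (area R)) _ mT _ (f := EFin \o f)).
- exact: measurable_funP.
- exact: law_subset.
- exact: measurable_int fi.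
Qed.

Lemma triangle_quadrature_order1 :
  quadrature_order P T 1 (fun f o => orbit_average f (X o)).
Proof.
(* Exactness holds at every outcome, since the orbit average of an affine function is constant on
   the whole plane. *)
apply: aeW => o p /polyfun_affine[a [b [c pE]]].
by rewrite (funext pE) orbit_average_affine integral_affine.
Qed.

Lemma triangle_quadrature_stochastic :
  stochastic_quadrature P T (fun f o => orbit_average f (X o)).
Proof.
have mx (j : 'I_3) : measurable_fun [set: Om] (act (rot ^+ j) \o X).
  by apply: measurableT_comp; [exact: measurable_act|exact: measurable_funP].
exists 3, (fun j => mfun_Sub (mem_set (mx j))), (fun=> cst (Num.sqrt 3 / 4)).
split=> [j|f o].
  (* One null event serves all three points: if [X o] lies in the triangle, so do its rotations. *)
  exists (X @^-1` (~` T)); split.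
  - rewrite -[_ @^-1` _]setTI; apply: measurable_funP => //.
    exact: measurableC.
  - by apply: law_null; [exact: measurableC|rewrite setICl measure0].
  - by move=> o /= H /(act_rot_iter_triangle j).
rewrite !big_ord_recl big_ord0 /orbit_average/= expr0 act1 expr1 addr0.
by rewrite -!mulrDl addrA mulrC.
Qed.

(** The integrand agrees with a Borel function [g] only almost everywhere, so the proof computes
    with [g] and controls the outcomes at which some orbit point is exceptional. *)
Lemma triangle_quadrature_unbiased :
  quadrature_unbiased P T (fun f o => orbit_average f (X o)).
Proof.
move=> f [g gi [N [mN N0 fgN]]].
have fg x : T x -> ~ N x -> f x = g x.
  by move=> Tx Nx; apply: contrapT => fgx; apply/Nx/fgN => /(_ Tx).
have mrN (A : set (plane R)) : measurable A -> measurable (act rot @^-1` A).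
  exact: measurable_preimage_act.
(* Off [N3] no point of the orbit meets [N]; the set stays null because the rotation preserves
   area. *)
pose N3 := N `|` act rot @^-1` N `|` act rot @^-1` (act rot @^-1` N).
have mN3 : measurable N3 by apply: measurableU; [apply: measurableU|]; auto.
have N30 : area R N3 = 0%E.
  have N1 : area R (act rot @^-1` N) = 0%E by rewrite area_act_rot.
  have N2 : area R (act rot @^-1` (act rot @^-1` N)) = 0%E.
    by rewrite area_act_rot//; exact: mrN.
  apply: null_set_setU => //; [by apply: measurableU; auto|by auto|].
  by apply: null_set_setU; auto.
(* Off the null event [X \in B], [Q f] is the measurable function [G]. *)
pose B := ~` T `|` N3.
have mB : measurable B by apply: measurableU => //; exact: measurableC.
(* Inside the triangle [B] is contained in the null set [N3], and the law gives no mass to the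
   outside. *)
have PB : P (X @^-1` B) = 0%E.
  apply: law_null => //; apply: (subset_measure0 _ mN3 _ N30).
    exact: measurableI.
  by move=> x [[]].
have mXB : measurable (X @^-1` B).
  by rewrite -[_ @^-1` _]setTI; exact: measurable_funP.
have mXT : measurable (X @^-1` T).
  by rewrite -[_ @^-1` _]setTI; exact: measurable_funP.
pose G : Om -> R := (fun o => orbit_average g (X o)) \_ (X @^-1` T).
have GE : EFin \o G = (fun o => (orbit_average g (X o))%:E) \_ (X @^-1` T).
  by apply/funext => o; rewrite /G /= !patchE; case: ifP.
have QG o : ~ (X @^-1` B) o -> orbit_average f (X o) = G o.
  move=> /= /not_orP[/contrapT TX /not_orP[/not_orP[n0 n1] n2]].
  rewrite /G patchE ifT ?inE// /orbit_average act_rot2.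
  have T1 := (act_rot_triangle (X o)).2 TX.
  by rewrite !fg//; exact/act_rot_triangle.
have gi' := integrable_orbit_average gi.
have iG : P.-integrable [set: Om] (EFin \o G).
  by rewrite GE; apply/(integrable_mkcond _ mXT); exact: (integrable_law gi').
split.
  by exists G => //; exists (X @^-1` B); split => // o /= /not_implyP[_ H];
    apply: contrapT => /QG.
rewrite unlock.
rewrite (negligible_eq_integral (f := fun o => (orbit_average f (X o))%:E)
  (g := EFin \o G) mXB PB); last by move=> o _ /QG /= ->.
rewrite GE -integral_mkcond integral_law// integral_orbit_average//.
(* The density [k^-1] of the law cancels the area produced by the orbit average; it remains to
   exchange [g] for [f]. *)
rewrite area_equilateral_triangle muleA -EFinM mulVf ?gt_eqF// mul1e.
by apply: (negligible_eq_integral mN N0) => x Tx Nx; rewrite fg.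
Qed.

End law.

End triangle_quadrature.

Theorem mainTheorem1 (R : realType) (d : measure_display)
    (Om : measurableType d) (P : probability Om R) (X : {RV P >-> plane R}) :
  let T : set (plane R) :=
    closed_triangle (0, 1) (- (Num.sqrt 3 / 2), - (1 / 2))
      (Num.sqrt 3 / 2, - (1 / 2)) in
  let rot : 'M[R]_2 := rotation (2 * pi / 3) in
  let Q (f : plane R -> R) (o : Om) : R :=
    Num.sqrt 3 / 4 *
      (f (X o) + f (act rot (X o)) + f (act (rot ^+ 2) (X o))) in
  uniformly_distributed X T ->
  [/\ stochastic_quadrature P T Q,
      quadrature_order P T 1 Q &
      quadrature_unbiased P T Q].
Proof.
move=> T rot Q XT.
split; last exact: triangle_quadrature_unbiased.
  exact: triangle_quadrature_stochastic.
exact: triangle_quadrature_order1.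
Qed.
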